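(* Let $p$ be an $n$-component Gauss phrase and let $1\le k\le n$. Then $B_k(p)$ contains an even number of $k$-odd vectors.
   Context: A word on an alphabet (finite set) $\mathcal{A}$ is a finite, possibly empty, sequence of letters of $\mathcal{A}$. A Gauss word on $\mathcal{A}$ is a word on $\mathcal{A}$ in which every letter of $\mathcal{A}$ appears exactly twice. A Gauss phrase on $\mathcal{A}$ is a finite sequence of words $x_1,\dots,x_m$ on $\mathcal{A}$ whose concatenation $x_1x_2\cdots x_m$ is a Gauss word on $\mathcal{A}$; the $x_i$ are its components. Write $K_n=(\mathbb{Z}/2\mathbb{Z})^n$. A vector in $K_n$ is $k$-odd if its $k$th entry is $1$. Let $p$ be an $n$-component Gauss phrase. For a (contiguous) subword $w$ of a component of $p$, the linking vector $\overrightarrow{l(w)}\in K_n$ is the vector whose $i$th entry is the number, modulo $2$, of letters which occur exactly once in $w$ and whose other occurrence is in the $i$th component of $p$. A single-component letter is a letter both of whose occurrences are in the same component. If $A$ is a single-component letter in the $k$th component, that component has the form $xAyAz$ with $x,y,z$ possibly empty words, and the linking vector of $A$ is $\overrightarrow{l(A)}=\overrightarrow{l(y)}$. Let $\mathcal{A}_k$ be the set of single-component letters appearing in the $k$th component of $p$, and for $\vec v\in K_n$ let $d_k(\vec v)=\#\{X\in\mathcal{A}_k : \overrightarrow{l(X)}=\vec v\}$. Define $$B_k(p)=\{\vec v\in K_n-\{\vec 0\} : d_k(\vec v)\text{ is odd}\}.$$ *)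

(* Defs.v *)
From mathcomp Require Import all_boot all_order all_algebra.

Set Implicit Arguments.
Unset Strict Implicit.
Unset Printing Implicit Defensive.

Import GRing.Theory.
Local Open Scope ring_scope.

Definition gauss_word (A : finType) (w : seq A) : bool :=
  [forall X : A, count_mem X w == 2%N].

Definition gauss_phrase (A : finType) (n : nat) (p : n.-tuple (seq A)) : bool :=
  gauss_word (flatten p).

Notation K n := 'rV['F_2]_n.

Definition is_odd_vec (n : nat) (k : 'I_n) (v : K n) : bool := v 0 k == 1.

(* A subword is given by the half-open interval of positions [s, t[, not just
   by its letters, so that "the other occurrence" of a letter makes sense. *)
Definition subword (A : Type) (c : seq A) (s t : nat) : seq A :=
  take (t - s) (drop s c).

Definition outside (A : Type) (c : seq A) (s t : nat) : seq A :=
  take s c ++ drop t c.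

(* In a Gauss phrase, the other occurrence of a letter X occurring once in the
   subword [s, t[ of the k-th component lies in the i-th component iff X occurs
   in that component, the positions [s, t[ being discarded when i = k. *)
Definition linking_vector (A : finType) (n : nat) (p : n.-tuple (seq A))
    (k : 'I_n) (s t : nat) : K n :=
  \row_(i < n) #|[set X : A | (count_mem X (subword (tnth p k) s t) == 1%N) &&
    (X \in if i == k then outside (tnth p k) s t else tnth p i)]|%:R.

Definition single_component_letters (A : finType) (n : nat)
    (p : n.-tuple (seq A)) (k : 'I_n) : {set A} :=
  [set X : A | count_mem X (tnth p k) == 2%N].

Definition first_pos (A : eqType) (X : A) (c : seq A) : nat := index X c.

Definition second_pos (A : eqType) (X : A) (c : seq A) : nat :=
  ((first_pos X c).+1 + index X (drop (first_pos X c).+1 c))%N.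

Definition letter_linking_vector (A : finType) (n : nat) (p : n.-tuple (seq A))
    (k : 'I_n) (X : A) : K n :=
  let c := tnth p k in
  linking_vector p k (first_pos X c).+1 (second_pos X c).

Lemma subword_between (A : eqType) (X : A) (x y z : seq A) :
  count_mem X (x ++ X :: y ++ X :: z) = 2%N ->
  let c := x ++ X :: y ++ X :: z in
  subword c (first_pos X c).+1 (second_pos X c) = y /\
  outside c (first_pos X c).+1 (second_pos X c) = rcons x X ++ X :: z.
Proof.
move=> cnt c; move: cnt; rewrite count_cat /= count_cat /= eqxx => cnt.
have /count_memPn xNX : count_mem X x = 0%N.
  by move: cnt; rewrite !add1n !addnS => -[] /eqP; rewrite addn_eq0 => /andP[/eqP].
have /count_memPn yNX : count_mem X y = 0%N.
  move: cnt; rewrite !add1n !addnS => -[] /eqP.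
  by rewrite !addn_eq0 => /and3P[_ /eqP].
have p1 : first_pos X c = size x.
  by rewrite /first_pos /c index_cat (negPf xNX) /= eqxx addn0.
have d1 : drop (size x).+1 c = y ++ X :: z.
  by rewrite /c -cat_rcons drop_size_cat // size_rcons.
have t1 : take (size x).+1 c = rcons x X.
  by rewrite /c -cat_rcons take_size_cat // size_rcons.
have p2 : second_pos X c = ((size x).+1 + size y)%N.
  by rewrite /second_pos p1 d1 index_cat (negPf yNX) /= eqxx addn0.
split; first by rewrite /subword p1 p2 d1 addKn take_size_cat.
by rewrite /outside p1 p2 addnC -drop_drop d1 t1 drop_size_cat.
Qed.

Definition d (A : finType) (n : nat) (p : n.-tuple (seq A)) (k : 'I_n)
    (v : K n) : nat :=
  #|[set X in single_component_letters p k | letter_linking_vector p k X == v]|.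

Definition B (A : finType) (n : nat) (p : n.-tuple (seq A)) (k : 'I_n) :
    {set K n} :=
  [set v : K n | (v != 0) && odd (d p k v)].

(* Main.v *)
Require Import Defs.
From mathcomp Require Import all_boot all_order all_algebra.

(** The k-th entry of the linking vector of a letter X of the k-th component
    counts the letters of that component interlaced with X.  Interlacement is
    symmetric and irreflexive, so by the handshake lemma an even number of
    letters have a k-odd linking vector; grouping these letters by linking
    vector, the classes of odd size are exactly the k-odd vectors of B_k. *)

Set Implicit Arguments.
Unset Strict Implicit.
Unset Printing Implicit Defensive.

Lemma odd_sum (I : finType) (P : pred I) (f : I -> nat) :
  odd (\sum_(i | P i) f i) = odd #|[set i | P i && odd (f i)]|.
Proof.
have oddM := big_morph odd oddD (erefl : odd 0 = false).
rewrite cardsE -sum1_card big_mkcondr !oddM.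
by apply: eq_bigr => i _; case: (odd (f i)).
Qed.

(** Ordering the vertices by [enum_rank] splits each degree into edges going up and edges going
    down. Exchanging the summations and using symmetry makes the two totals equal, so their sum is a
    double. *)
Lemma handshake (T : finType) (S : {set T}) (e : rel T) :
    {in S &, symmetric e} -> {in S, irreflexive e} ->
  ~~ odd (\sum_(x in S) #|[set y in S | e x y]|).
Proof.
move=> esym eirr.
pose lt (x y : T) := enum_rank x < enum_rank y.
have split_deg x : x \in S -> #|[set y in S | e x y]| =
    \sum_(y in S) (e x y && lt x y) + \sum_(y in S) (e x y && lt y x).
  move=> Sx; rewrite -big_split cardsE -sum1_card big_mkcondr /=.
  apply: eq_bigr => y Sy; rewrite /lt.
  case: ltngtP => [||/val_inj/enum_rank_inj xy]; rewrite ?andbT ?andbF.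
  - by case: (e x y).
  - by case: (e x y).
  (* On the diagonal [lt] fails in both directions, so the right side is 0 and a loop would break
     the equality. *)
  - by rewrite -xy eirr.
rewrite (eq_bigr _ split_deg) big_split /= [X in _ + X]exchange_big /=.
rewrite [X in _ + X](_ : _ = \sum_(x in S) \sum_(y in S) (e x y && lt x y)).
  by rewrite addnn odd_double.
by apply: eq_bigr => x Sx; apply: eq_bigr => y Sy; rewrite esym.
Qed.

Section Interlacement.

Variables (A : eqType) (c : seq A).
Implicit Types X Y : A.

(** This is verbatim the condition under which [linking_vector] counts [Y] in its [k]-th entry, so
    that entry folds to it. Its symmetry is therefore not visible and has to be proved. *)
Definition interlaced X Y : bool :=
  let s := (first_pos X c).+1 in let t := second_pos X c in
  (count_mem Y (subword c s t) == 1) && (Y \in outside c s t).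

Lemma count2_split X : count_mem X c = 2 ->
  exists x y z, c = x ++ X :: y ++ X :: z.
Proof.
move=> cnt; have Xc : X \in c by rewrite -has_pred1 has_count cnt.
move: cnt; case/splitPr: Xc => x w; rewrite count_cat /= eqxx => cnt.
(* The split may have been made at either occurrence of [X], so the remaining one is in [w] or in
   [x]. *)
have [Xw|/count_memPn wX] := boolP (X \in w).
  by case/splitPr: Xw => y z; exists x, y, z.
have Xx : X \in x by rewrite -has_pred1 has_count; move: cnt; rewrite wX; case: count.
by case/splitPr: Xx => x1 x2; exists x1, x2, w; rewrite -catA.
Qed.

Lemma interlacedE X x y z Y : count_mem X c = 2 -> c = x ++ X :: y ++ X :: z ->
  interlaced X Y = (count_mem Y y == 1) && (Y \in rcons x X ++ X :: z).
Proof. by move=> + ce; rewrite /interlaced ce => /subword_between [-> ->]. Qed.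

Lemma interlaced_irr X : count_mem X c = 2 -> interlaced X X = false.
Proof.
move=> cX; have [x [y [z ce]]] := count2_split cX.
rewrite (interlacedE _ cX ce); move: cX; rewrite ce.
rewrite count_cat /= count_cat /= eqxx.
by case: eqP => [->|//]; rewrite addnCA !addnS.
Qed.

(** One occurrence of [Y] lies between those of [X] and at least one lies outside. The linking
    vector counts over the whole alphabet; this confines the count to single-component letters,
    where the handshake lemma applies. *)
Lemma interlaced_count X Y : count_mem X c = 2 -> count_mem Y c <= 2 ->
  interlaced X Y -> count_mem Y c = 2.
Proof.
move=> cX cY2 e; have [x [y [z ce]]] := count2_split cX.
have neq : X != Y by apply: contraTneq e => <-; rewrite interlaced_irr.
move: e; rewrite (interlacedE _ cX ce) => /andP[/eqP y1].
rewrite -has_pred1 has_count -cats1 !count_cat /= (negPf neq) => out.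
apply/eqP; rewrite eqn_leq cY2 ce count_cat /= count_cat /= (negPf neq) y1.
by move: out; rewrite !add0n addn0 addnCA add1n.
Qed.

Lemma interlaced_imp X Y : count_mem X c = 2 -> count_mem Y c = 2 ->
  interlaced X Y -> interlaced Y X.
Proof.
move=> cX cY e; have [x [y [z ce]]] := count2_split cX.
have neq : Y != X by apply: contraTneq e => ->; rewrite interlaced_irr.
move: e; rewrite (interlacedE _ cX ce) => /andP[/eqP y1].
rewrite mem_cat mem_rcons !inE (negPf neq) /= => out.
have Yy : Y \in y by rewrite -has_pred1 has_count y1.
case/splitPr: Yy ce {y1} => y1 y2 ce.
(* The two displayed occurrences of [X] exhaust its count. *)
have cnt : count_mem X x = 0 /\ count_mem X y1 = 0 /\
    count_mem X y2 = 0 /\ count_mem X z = 0.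
  move: cX; rewrite ce count_cat /= !count_cat /= eqxx (negPf neq).
  rewrite !add0n !add1n !addnS => -[] /eqP.
  by rewrite !addn_eq0 => /and3P[/eqP-> /andP[/eqP-> /eqP->] /eqP->].
have [x0 [y10 [y20 z0]]] := cnt.
(* The pattern is [Y X Y X] if the outer [Y] is in [x], and [X Y X Y] if it is in [z]. Either way
   exactly one [X] separates the two [Y] and the other is outside. *)
case/orP: out => [Yx|Yz].
  case/splitPr: Yx ce x0 {cnt} => x1 x2 ce x0.
  have ce' : c = x1 ++ Y :: (x2 ++ X :: y1) ++ Y :: (y2 ++ X :: z).
    by rewrite ce -!catA /= -?catA.
  rewrite (interlacedE _ cY ce') !(mem_cat, inE) eqxx !orbT andbT.
  move: x0; rewrite !count_cat /= eqxx y10 (negPf neq) => /eqP.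
  by rewrite !addn_eq0 => /and3P[_ _ /eqP->].
case/splitPr: Yz ce z0 {cnt} => z1 z2 ce z0.
have ce' : c = (x ++ X :: y1) ++ Y :: (y2 ++ X :: z1) ++ Y :: z2.
  by rewrite ce -!catA /= -?catA.
rewrite (interlacedE _ cY ce') !(mem_cat, mem_rcons, inE) eqxx !orbT andbT.
move: z0; rewrite !count_cat /= eqxx y20 (negPf neq) => /eqP.
by rewrite !addn_eq0 => /andP[/eqP-> _].
Qed.

Lemma interlaced_sym X Y : count_mem X c = 2 -> count_mem Y c = 2 ->
  interlaced X Y = interlaced Y X.
Proof. by move=> cX cY; apply/idP/idP; apply: interlaced_imp. Qed.

End Interlacement.

Lemma natr_F2_eq1 m : (m%:R == 1 :> 'F_2)%R = odd m.
Proof. by rewrite -val_eqE /= val_Fp_nat // modn2; case: odd. Qed.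

Section GaussPhrase.

Variables (A : finType) (n : nat) (p : n.-tuple (seq A)).
Hypothesis hp : gauss_phrase p.
Variable k : 'I_n.

Lemma count_component_le2 X : count_mem X (tnth p k) <= 2.
Proof.
have /forallP/(_ X)/eqP <- := hp.
have [s1 s2] := splitPr (mem_tnth k p).
by rewrite flatten_cat /= !count_cat addnCA leq_addr.
Qed.

Lemma is_odd_letter_linking_vector X : X \in single_component_letters p k ->
  is_odd_vec k (letter_linking_vector p k X) =
  odd #|[set Y in single_component_letters p k | interlaced (tnth p k) X Y]|.
Proof.
rewrite inE => /eqP cX.
rewrite /is_odd_vec mxE natr_F2_eq1 eqxx; congr (odd _).
apply: eq_card => Y; rewrite !inE -/(interlaced _ X Y).
apply/idP/andP => [e|[]//]; split=> //.
by apply/eqP/(interlaced_count cX) => //; apply: count_component_le2.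
Qed.

Lemma even_odd_linking_letters :
  ~~ odd #|[set X in single_component_letters p k |
              is_odd_vec k (letter_linking_vector p k X)]|.
Proof.
rewrite (_ : [set X in _ | _] = [set X | (X \in single_component_letters p k) &&
    odd #|[set Y in single_component_letters p k
             | interlaced (tnth p k) X Y]|]).
  rewrite -odd_sum; apply: handshake => [X Y|X]; rewrite !inE.
    by move=> /eqP cX /eqP cY; apply: interlaced_sym.
  by move=> /eqP; apply: interlaced_irr.
apply/setP=> X; rewrite in_set [RHS]in_set; apply: andb_id2l.
exact: is_odd_letter_linking_vector.
Qed.

(** The letters are partitioned into the fibres of the linking vector map, whose sizes are the
    [d p k v]. *)
Lemma sum_d (P : pred (K n)) :
  \sum_(v | P v) d p k v =
  #|[set X in single_component_letters p k | P (letter_linking_vector p k X)]|.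
Proof.
rewrite cardsE -sum1_card.
rewrite (partition_big (letter_linking_vector p k) P) => [|X /andP[]//].
apply: eq_bigr => v Pv; rewrite /d cardsE -sum1_card; apply: eq_bigl => X.
rewrite !unfold_in -andbA; congr (_ && _).
by case: eqP => [->|_]; rewrite ?Pv ?andbF.
Qed.

End GaussPhrase.

Theorem proposition5p1 (A : finType) (n : nat) (p : n.-tuple (seq A))
    (hp : gauss_phrase p) (k : 'I_n) :
  ~~ odd #|[set v in B p k | is_odd_vec k v]|.
Proof.
rewrite (_ : [set v in _ | _] = [set v | is_odd_vec k v && odd (d p k v)]).
  by rewrite -odd_sum sum_d even_odd_linking_letters.
apply/setP=> v; rewrite !inE andbC; case ov: (is_odd_vec k v) => //=.
(* A [k]-odd vector is nonzero, since the [k]-th entry of 0 is 0. *)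
by rewrite (_ : v != 0%R) //; apply: contraTneq ov => ->; rewrite /is_odd_vec mxE.
Qed.
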